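(* Let $A$ be an integral domain. If the polynomial ring $A[X_1,\dots,X_n]$ is a graded globally perinormal domain with the natural $\mathbb{Z}_{\geq0}^n$-grading, then $A$ is a globally perinormal domain.
   Context: The natural $\mathbb{Z}_{\ge0}^n$-grading on $A[X_1,\dots,X_n]$ has degree $(z_1,\dots,z_n)$ component $AX_1^{z_1}\cdots X_n^{z_n}$ (and is regarded as a $\mathbb{Z}^n$-grading with zero components in the remaining degrees). The graded quotient field of a graded domain $R$ is $R_H$, where $H$ is the set of nonzero homogeneous elements; $f/g$ (with $f,g$ homogeneous, $g\neq0$) has degree $\deg f-\deg g$. A graded overring of $R$ is a graded subring of $R_H$ containing $R$. $h\text{-Spec}$ denotes the set of graded (homogeneous) prime ideals. A graded overring $S$ of $R$ satisfies gGD (graded going-down) if whenever $P,Q\in h\text{-Spec}(R)$ and $\tilde Q\in h\text{-Spec}(S)$ with $P\subseteq Q$ and $\tilde Q\cap R=Q$, there exists $\tilde P\in h\text{-Spec}(S)$ with $\tilde P\subseteq\tilde Q$ and $\tilde P\cap R=P$. A graded domain $R$ is a graded globally perinormal domain if every graded overring of $R$ satisfying gGD over $R$ is a localization of $R$. An overring of an integral domain $A$ is a ring between $A$ and its quotient field; it is a going-down overring if the extension satisfies going-down. $A$ is globally perinormal if every going-down overring of $A$ is a localization of $A$. A localization of a domain $R$ is a ring $R_W$ with $W$ a multiplicative subset of $R$. *)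

(* Defs.v *)
From HB Require Import structures.
From mathcomp Require Import all_boot all_order all_algebra.
From mathcomp Require Import boolp classical_sets.
From mathcomp Require Import mpoly.

Set Implicit Arguments.
Unset Strict Implicit.
Unset Printing Implicit Defensive.

Import GRing.Theory.
Local Open Scope classical_set_scope.
Local Open Scope ring_scope.

(* All rings in play lie between an integral domain R and its field of        *)
(* fractions K = {fraction R}; they are handled as subsets of K, and R itself *)
(* as the image of the canonical embedding tofrac : R -> K.                   *)

Definition base (R : idomainType) : set {fraction R} := range (@tofrac R).

Arguments base R : clear implicits.

(* Division by 0 is total in K, so W must exclude 0 explicitly.                *)
Definition multiplicative_subset (R : idomainType) (W : set R) : Prop :=
  [/\ W 1, forall x y, W x -> W y -> W (x * y) & ~ W 0].

Definition localization (R : idomainType) (W : set R) : set {fraction R} :=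
  [set x | exists r w, W w /\ x = tofrac r / tofrac w].

Definition is_localization (R : idomainType) (S : set {fraction R}) : Prop :=
  exists W : set R, multiplicative_subset W /\ S = localization W.

Definition ideal (K : fieldType) (S I : set K) : Prop :=
  [/\ I `<=` S, GRing.zmod_closed (mem I)
    & forall a x, S a -> I x -> I (a * x)].

Definition prime_ideal (K : fieldType) (S P : set K) : Prop :=
  [/\ ideal S P, P <> S
    & forall x y, S x -> S y -> P (x * y) -> P x \/ P y].

Definition Spec (K : fieldType) (S : set K) : set (set K) :=
  [set P | prime_ideal S P].

(* The going-down condition over the subring R, relative to given sets of     *)
(* primes of R and of its overring.                                           *)
Definition going_down (K : fieldType) (R : set K)
    (specR specS : set (set K)) : Prop :=
  forall P Q Q' : set K, specR P -> specR Q -> specS Q' ->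
    P `<=` Q -> Q' `&` R = Q ->
    exists P' : set K, [/\ specS P', P' `<=` Q' & P' `&` R = P].

Definition overring (A : idomainType) (B : set {fraction A}) : Prop :=
  GRing.subring_closed (mem B) /\ base A `<=` B.

Definition globally_perinormal (A : idomainType) : Prop :=
  forall B : set {fraction A}, overring B ->
    going_down (base A) (Spec (base A)) (Spec B) -> is_localization B.

(* For S closed under addition and comp a family of summands of V in direct   *)
(* sum, this says S = \bigoplus_g (S `&` comp g).                             *)
Definition graded_subset (G : zmodType) (V : zmodType) (comp : G -> set V)
    (S : set V) : Prop :=
  forall x, S x -> exists (s : seq G) (f : G -> V),
    [/\ uniq s, forall g, g \in s -> (comp g `&` S) (f g)
      & x = \sum_(g <- s) f g].

(* That 1 lies in degree 0 follows from the axioms, G being a group.          *)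
Record grading (R : idomainType) (G : zmodType) := Grading {
  gcomp :> G -> set R;
  gcomp_zmod : forall g, GRing.zmod_closed (mem (gcomp g));
  gcompM : forall g h x y, gcomp g x -> gcomp h y -> gcomp (g + h) (x * y);
  gcomp_sum : graded_subset gcomp setT;
  gcomp_direct : forall (s : seq G) (f : G -> R), uniq s ->
    (forall g, g \in s -> gcomp g (f g)) -> \sum_(g <- s) f g = 0 ->
    forall g, g \in s -> f g = 0
}.

Section Graded.
Variables (R : idomainType) (G : zmodType) (gr : grading R G).

Definition nz_homogeneous : set R := [set x | x <> 0 /\ exists g, gr g x].

Definition graded_quotient_field : set {fraction R} :=
  localization nz_homogeneous.

(* The components of the graded quotient field. A subring S of it is graded   *)
(* by the S `&` quot_comp g; for S = base R these are the images of the       *)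
(* components of R.                                                           *)
Definition quot_comp (g : G) : set {fraction R} :=
  [set x | exists a b f h,
    [/\ gr a f, gr b h, h <> 0, g = a - b & x = tofrac f / tofrac h]].

Definition hSpec (S : set {fraction R}) : set (set {fraction R}) :=
  [set P | prime_ideal S P /\ graded_subset quot_comp P].

Definition graded_overring (S : set {fraction R}) : Prop :=
  [/\ GRing.subring_closed (mem S), base R `<=` S,
      S `<=` graded_quotient_field & graded_subset quot_comp S].

Definition gGD (S : set {fraction R}) : Prop :=
  going_down (base R) (hSpec (base R)) (hSpec S).

Definition graded_globally_perinormal : Prop :=
  forall S : set {fraction R}, graded_overring S -> gGD S ->
    is_localization S.

End Graded.

Section NaturalGrading.
Variables (A : idomainType) (n : nat).

Definition mdegree (m : 'X_{1..n}) : 'rV[int]_n := \row_i (m i)%:Z.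

Definition natural_comp (z : 'rV[int]_n) : set {mpoly A[n]} :=
  [set p | p = 0 \/ exists (a : A) (m : 'X_{1..n}),
     z = mdegree m /\ p = a *: 'X_[m]].

Lemma mdegree_inj : injective mdegree.
Proof.
move=> m1 m2 /rowP e; apply/mnmP => i.
by have := e i; rewrite !mxE => -[].
Qed.

Lemma natural_comp_zmod z : GRing.zmod_closed (mem (natural_comp z)).
Proof.
split=> [|p q]; first by rewrite inE; left.
rewrite !inE => -[->|[a [m [zm ->]]]] [->|[b [m' [zm' ->]]]].
- by left; rewrite subr0.
- by right; exists (- b), m'; rewrite sub0r scaleNr.
- by right; exists a, m; rewrite subr0.
- right; exists (a - b), m; split=> //.
  by rewrite scalerBl; congr (_ - _ *: 'X_[_]); apply: mdegree_inj; rewrite -zm.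
Qed.

Lemma natural_compM z z' p q :
  natural_comp z p -> natural_comp z' q -> natural_comp (z + z') (p * q).
Proof.
move=> [->|[a [m [-> ->]]]] [->|[b [m' [-> ->]]]];
  rewrite ?mul0r ?mulr0; try by left.
right; exists (a * b), (m + m')%MM; split.
  by apply/rowP => i; rewrite !mxE mnmDE PoszD.
by rewrite -scalerAl -scalerAr scalerA mpolyXD.
Qed.

Lemma natural_comp_sum : graded_subset natural_comp setT.
Proof.
move=> p _; pose mon z := [pick m : seq_sub (msupp p) | mdegree (ssval m) == z].
pose f z := if mon z is Some m then p@_(ssval m) *: 'X_[ssval m] else 0.
exists (map mdegree (msupp p)), f; split.
- by rewrite (map_inj_uniq mdegree_inj) msupp_uniq.
- move=> z _; split=> //; rewrite /f /mon.
  case: pickP => [m /eqP <-|_]; last by left.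
  by right; exists p@_(ssval m), (ssval m).
- rewrite big_map [LHS]mpolyE; apply: eq_big_seq => m mp.
  rewrite /f /mon; case: pickP => [m' /eqP/mdegree_inj -> //|].
  by move=> /(_ (SeqSub mp)); rewrite eqxx.
Qed.

Lemma natural_comp_direct (s : seq 'rV[int]_n) (f : 'rV[int]_n -> {mpoly A[n]}) :
  uniq s -> (forall z, z \in s -> natural_comp z (f z)) ->
  \sum_(z <- s) f z = 0 -> forall z, z \in s -> f z = 0.
Proof.
move=> us fs s0 z zs; case: (fs z zs) => [//|[a [m [zm fz]]]].
have := congr1 (mcoeff m) s0; rewrite raddf_sum /= mcoeff0 (bigD1_seq z) //=.
rewrite big_seq_cond big1 ?addr0 => [|z' /andP[z's z'z]].
  by rewrite fz mcoeffZ mcoeffX eqxx mulr1 => ->; rewrite scale0r.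
case: (fs z' z's) => [->|[b [m' [z'm' ->]]]]; first by rewrite mcoeff0.
rewrite mcoeffZ mcoeffX; case: eqP => [mm|_]; last by rewrite mulr0.
by rewrite z'm' mm -zm eqxx in z'z.
Qed.

Definition natural_grading : grading {mpoly A[n]} 'rV[int]_n :=
  Grading natural_comp_zmod natural_compM natural_comp_sum natural_comp_direct.

End NaturalGrading.

(* Main.v *)
Require Import Defs.
From HB Require Import structures.
From mathcomp Require Import all_boot all_algebra.
From mathcomp Require Import boolp classical_sets.
From mathcomp Require Import mpoly ring.

(** Write A[X] for A[X_1, ..., X_n] and K for the fraction field of A. Given a
    going-down overring B of A, the proof applies the hypothesis to the graded
    overring B[X] of A[X] and recovers B from B[X] as its ring of constants.

    The grading by monomials has components of rank one, so homogeneous primes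
    of C[X], for a subring C of K, are transparent: they are exactly the ideals
    q C[X] + (X_i : i in I), for a prime q of C and a set I of variables
    (face_hSpec and hSpec_face). The contraction from B[X] to A[X] only contracts q
    and keeps I (face_base). Hence graded going-down of B[X] over A[X] reduces to
    going-down of B over A (gGD_polys), and B[X] is a localization A[X]_W by
    hypothesis. The elements of W are invertible in B[X], so they are constants,
    and taking constant coefficients exhibits B as a localization of A
    (localization_descent).

    Everything takes place in Frac A[X]. Elements of B[X] are reached through the
    embedding emb of K[X], and C[X] and its homogeneous primes are sets of
    polynomials defined by a condition on each coefficient (mono_set). *)

Set Implicit Arguments.
Unset Strict Implicit.
Unset Printing Implicit Defensive.

Import GRing.Theory.
Local Open Scope classical_set_scope.
Local Open Scope ring_scope.

(** * Closed subsets of rings *)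

Section ClosedSets.

Lemma zmod_closedP (V : zmodType) (S : set V) :
  GRing.zmod_closed (mem S) <-> S 0 /\ forall x y, S x -> S y -> S (x - y).
Proof.
split=> [[S0 SB]|[S0 SB]].
  split=> [|x y Sx Sy]; first by move: S0; rewrite inE.
  by have := SB x y; rewrite !inE; apply.
by split=> [|x y]; rewrite !inE; [|exact: SB].
Qed.

Lemma subring_closedP (R : nzRingType) (S : set R) :
  GRing.subring_closed (mem S) <->
  [/\ S 1, forall x y, S x -> S y -> S (x - y) &
      forall x y, S x -> S y -> S (x * y)].
Proof.
split=> [[S1 SB SM]|[S1 SB SM]].
  split=> [|x y Sx Sy|x y Sx Sy]; first by move: S1; rewrite inE.
    by have := SB x y; rewrite !inE; apply.
  by have := SM x y; rewrite !inE; apply.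
by split=> [|x y|x y]; rewrite !inE; [|exact: SB|exact: SM].
Qed.

Lemma zmod_closed_sum (V : zmodType) (S : set V) (I : eqType) (r : seq I)
    (f : I -> V) :
  GRing.zmod_closed (mem S) -> (forall i, i \in r -> S (f i)) ->
  S (\sum_(i <- r) f i).
Proof.
move=> /zmod_closedP[S0 SB] Sf; rewrite big_seq.
elim/big_ind: _ => // x y Sx Sy.
by rewrite -[y]opprK; apply: (SB) => //; rewrite -sub0r; apply: SB.
Qed.

End ClosedSets.

Lemma base_subring (R : idomainType) : GRing.subring_closed (mem (base R)).
Proof.
apply/subring_closedP; split; first by exists 1; rewrite // rmorph1.
  by move=> _ _ [x _ <-] [y _ <-]; exists (x - y); rewrite // rmorphB.
by move=> _ _ [x _ <-] [y _ <-]; exists (x * y); rewrite // rmorphM.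
Qed.

(** * Extending an injective ring morphism to the field of fractions *)

Section FractionLift.
Variables (R : idomainType).

Lemma fracE (x : {fraction R}) :
  x = tofrac \n_(repr x) / tofrac \d_(repr x).
Proof.
have d0 := denom_ratioP (repr x).
apply: (canRL (mulfK _)); first by rewrite tofrac_eq0.
rewrite -{1}[x]reprK; move: (repr x) d0 => r d0.
change (FracField.mul (\pi_(FracField.type R) r)%qT (tofrac \d_r) = tofrac \n_r).
unlock FracField.tofrac; rewrite -[LHS]FracField.pi_mul.
apply/eqmodP; rewrite /= FracField.equivfE /FracField.mulf.
by rewrite !numden_Ratio ?mulf_neq0 ?oner_eq0 //= !mulr1 mulrC.
Qed.

Variables (F : fieldType) (f : {rmorphism R -> F}).
Hypothesis f_inj : injective f.

(** The formula uses a chosen representative; frac_lift_div shows that it does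
    not depend on this choice, and everything else follows from that. *)
Definition frac_lift (x : {fraction R}) : F :=
  f \n_(repr x) / f \d_(repr x).

Let f0 a : (f a == 0) = (a == 0).
Proof. by rewrite -(inj_eq f_inj) rmorph0. Qed.

Lemma frac_lift_div a b :
  b != 0 -> frac_lift (tofrac a / tofrac b) = f a / f b.
Proof.
move=> b0; rewrite /frac_lift; move E: (tofrac a / tofrac b) => x.
have d0 := denom_ratioP (repr x).
(* Both sides become the equality of cross products in R, which is the
   equality of the two fractions there. *)
apply/eqP; rewrite eqr_div ?f0 // -!rmorphM (inj_eq f_inj) -tofrac_eq !rmorphM.
by rewrite -eqr_div ?tofrac_eq0 // E -fracE.
Qed.

Lemma frac_lift_tofrac a : frac_lift (tofrac a) = f a.
Proof.
have := @frac_lift_div a 1; rewrite !rmorph1 !divr1; apply.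
exact: oner_neq0.
Qed.

Fact frac_lift_is_zmod_morphism : zmod_morphism frac_lift.
Proof.
move=> x y; rewrite (fracE x) (fracE y).
have := denom_ratioP (repr x); have := denom_ratioP (repr y).
move: \n_(repr x) \d_(repr x) \n_(repr y) \d_(repr y) => a b c d d0 b0.
have -> : tofrac a / tofrac b - tofrac c / tofrac d =
  tofrac (a * d - c * b) / tofrac (b * d).
  by rewrite -[in LHS]mulNr addf_div ?tofrac_eq0 // !rmorphB !rmorphM mulNr.
rewrite !frac_lift_div ?mulf_neq0 //.
by rewrite -[in RHS]mulNr addf_div ?f0 // !rmorphB !rmorphM mulNr.
Qed.

Fact frac_lift_is_monoid_morphism : monoid_morphism frac_lift.
Proof.
split=> [|x y]; first by rewrite -tofrac1 frac_lift_tofrac rmorph1.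
rewrite (fracE x) (fracE y).
have := denom_ratioP (repr x); have := denom_ratioP (repr y).
move: \n_(repr x) \d_(repr x) \n_(repr y) \d_(repr y) => a b c d d0 b0.
by rewrite mulf_div -!rmorphM !frac_lift_div ?mulf_neq0 // mulf_div !rmorphM.
Qed.

End FractionLift.

(** * Polynomials over Frac A inside Frac A[X_1, ..., X_n] *)

Section PolynomialEmbedding.
Variables (A : idomainType) (n : nat).

Local Notation K := {fraction A}.
Local Notation L := {fraction {mpoly A[n]}}.
Local Notation toK := (@tofrac A).
Local Notation toL := (@tofrac {mpoly A[n]}).

Implicit Types (D E : 'X_{1..n} -> set K) (B C : set K) (F G : {mpoly K[n]}).

Definition tofrac_const : {rmorphism A -> L} := toL \o @mpolyC n A.

Lemma tofrac_const_inj : injective tofrac_const.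
Proof. by move=> a b /eqP; rewrite tofrac_eq mpolyC_eq => /eqP. Qed.

Definition const_emb : K -> L := frac_lift tofrac_const.

HB.instance Definition _ := GRing.isZmodMorphism.Build K L const_emb
  (frac_lift_is_zmod_morphism tofrac_const_inj).
HB.instance Definition _ := GRing.isMonoidMorphism.Build K L const_emb
  (frac_lift_is_monoid_morphism tofrac_const_inj).

Lemma const_emb_tofrac a : const_emb (toK a) = toL a%:MP.
Proof. exact: (frac_lift_tofrac tofrac_const_inj). Qed.

(** The inclusion of K[X_1, ..., X_n], K = Frac A, into Frac A[X_1, ..., X_n]. It
    lets subrings and ideals of the target be described by coefficients. *)
Definition emb : {rmorphism {mpoly K[n]} -> L} :=
  mmap const_emb (fun i => toL 'X_i).

Definition coef_frac : {rmorphism {mpoly A[n]} -> {mpoly K[n]}} := map_mpoly toK.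

Lemma embC c : emb c%:MP = const_emb c.
Proof. exact: mmapC. Qed.

Lemma embX m : emb 'X_[m] = toL 'X_[m].
Proof.
rewrite [LHS]mmapX /mmap1 [in RHS]mpolyXE_id rmorph_prod /=.
by apply: eq_bigr => i _; rewrite rmorphXn.
Qed.

Lemma embZ c m : emb (c *: 'X_[m]) = const_emb c * toL 'X_[m].
Proof. by rewrite -mul_mpolyC rmorphM /= embC embX. Qed.

Lemma emb_tofrac p : emb (coef_frac p) = toL p.
Proof.
elim/mpolyind: p => [|c m p _ _ IHp]; first by rewrite !rmorph0.
rewrite !rmorphD IHp; congr (_ + _).
by rewrite /= map_mpolyZ map_mpolyX /= embZ const_emb_tofrac -rmorphM mul_mpolyC.
Qed.

Lemma base_coef_frac (F : {mpoly K[n]}) :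
  (forall m, base A F@_m) -> exists p, F = coef_frac p.
Proof.
move=> FA; have /choice[a aE] : forall m, exists a, toK a = F@_m.
  by move=> m; have [a _ aE] := FA m; exists a.
exists (\sum_(m <- msupp F) a m *: 'X_[m]).
rewrite {1}(mpolyE F) raddf_sum; apply: eq_bigr => m _.
by rewrite /= map_mpolyZ map_mpolyX -aE.
Qed.

(** The product of the denominators of the coefficients clears them all. This
    transfers facts from A[X], which embeds in its fractions, to K[X]. *)
Lemma common_denominator (F : {mpoly K[n]}) :
  exists (d : A) p, d != 0 /\ (toK d)%:MP * F = coef_frac p.
Proof.
pose d := \prod_(m <- msupp F) \d_(repr F@_m).
have d0 : d != 0.
  rewrite prodf_seq_neq0; apply/allP => m _; apply/implyP => _.
  exact: denom_ratioP.
exists d; have [p pE] : exists p, (toK d)%:MP * F = coef_frac p; last by exists p.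
apply: base_coef_frac => m; rewrite mcoeffCM.
have [mF|/memN_msupp_eq0->] := boolP (m \in msupp F); last first.
  by exists 0; rewrite // rmorph0 mulr0.
exists (\prod_(k <- msupp F | k != m) \d_(repr F@_k) * \n_(repr F@_m)) => //.
rewrite [F@_m in RHS]fracE /d (bigD1_seq m) //= !rmorphM /=.
rewrite -mulrA mulrCA; congr (_ * _).
by rewrite mulrC divfK ?tofrac_eq0 ?denom_ratioP.
Qed.

Lemma emb_inj : injective emb.
Proof.
apply: raddf_inj => F F0; have [d [p [d0 dF]]] := common_denominator F.
have : emb ((toK d)%:MP * F) = 0 by rewrite rmorphM /= F0 mulr0.
rewrite dF emb_tofrac => /eqP; rewrite tofrac_eq0 => /eqP p0.
move/eqP: dF; rewrite p0 raddf0 mulf_eq0 mpolyC_eq0 tofrac_eq0.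
by rewrite (negbTE d0) => /eqP.
Qed.

(** Subsets of K[X] given by a separate condition on each coefficient. Both C[X]
    and all of its homogeneous primes have this form, and it makes them graded
    and compatible with intersections. *)
Definition mono_set (D : 'X_{1..n} -> set K) : set L :=
  emb @` [set F | forall m, D m F@_m].

Lemma mono_setE D F : mono_set D (emb F) <-> forall m, D m F@_m.
Proof. by split=> [[G DG /emb_inj <-] //|DF]; exists F. Qed.

Lemma mono_set_monomial D c m :
  (forall k, D k 0) -> mono_set D (emb (c *: 'X_[m])) <-> D m c.
Proof.
move=> D0; rewrite mono_setE; split=> [/(_ m)|Dc k].
  by rewrite mcoeffZ mcoeffX eqxx mulr1.
by rewrite mcoeffZ mcoeffX; case: eqP => [<-|_]; rewrite ?mulr1 ?mulr0.
Qed.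

Lemma mono_set_const D c :
  (forall k, D k 0) -> mono_set D (emb c%:MP) <-> D 0%MM c.
Proof. by move=> D0; rewrite -(mono_set_monomial c 0%MM D0) mpolyX0 alg_mpolyC. Qed.

Lemma mono_setI D E :
  mono_set D `&` mono_set E = mono_set (fun m => D m `&` E m).
Proof.
apply/seteqP; split=> [_ [[F DF <-] /mono_setE EF]|_ [F DEF <-]].
  by exists F.
by split; apply/mono_setE => m; have [] := DEF m.
Qed.

Lemma mono_set_subset D E :
  (forall m, D m `<=` E m) -> mono_set D `<=` mono_set E.
Proof. by move=> DE _ [F DF <-]; exists F => // m; apply: DE. Qed.

Lemma base_mono_set : base {mpoly A[n]} = mono_set (fun=> base A).
Proof.
apply/seteqP; split=> [_ [p _ <-]|_ [F /base_coef_frac[p ->] <-]].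
  by rewrite -emb_tofrac mono_setE => m; rewrite mcoeff_map_mpoly; exists p@_m.
by rewrite emb_tofrac; exists p.
Qed.

Lemma mono_set_zmod D :
  (forall m, GRing.zmod_closed (mem (D m))) ->
  GRing.zmod_closed (mem (mono_set D)).
Proof.
move=> Dz; apply/zmod_closedP; split=> [|_ _ [F DF <-] [G DG <-]].
  rewrite -(rmorph0 emb) mono_setE => m; rewrite mcoeff0.
  by have /zmod_closedP[] := Dz m.
rewrite -rmorphB mono_setE => m; rewrite mcoeffB.
by have /zmod_closedP[_] := Dz m; apply.
Qed.

Lemma mono_setM (D1 D2 D3 : 'X_{1..n} -> set K) x y :
  (forall m, GRing.zmod_closed (mem (D3 m))) ->
  (forall m k a b, D1 m a -> D2 k b -> D3 (m + k)%MM (a * b)) ->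
  mono_set D1 x -> mono_set D2 y -> mono_set D3 (x * y).
Proof.
move=> Dz D12 [F DF <-] [G DG <-]; rewrite -rmorphM mono_setE => m.
rewrite mcoeffM big_mkcond.
apply: (zmod_closed_sum (S := D3 m)) => [|k _]; first exact: Dz.
have [mE|_] := eqVneq m (k.1 + k.2)%MM; last by have /zmod_closedP[] := Dz m.
by rewrite [X in D3 X]mE; apply: D12.
Qed.

Lemma mono_set_subring C : GRing.subring_closed (mem C) ->
  GRing.subring_closed (mem (mono_set (fun=> C))).
Proof.
move=> Csub; have Cz := GRing.subring_closedB Csub.
have /zmod_closedP[C0 _] := Cz.
have /zmod_closedP[_ SB] := mono_set_zmod (fun=> Cz).
have /subring_closedP[C1 _ CM] := Csub.
apply/subring_closedP; split=> // [|x y].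
  by rewrite -(rmorph1 emb) -mpolyC1; apply/mono_set_const.
by apply: mono_setM => // _ _ a b; apply: CM.
Qed.

Local Notation gr := (natural_grading A n).

Lemma const_embE c : const_emb c = toL (\n_(repr c))%:MP / toL (\d_(repr c))%:MP.
Proof. by rewrite {1}(fracE c) fmorph_div /= !const_emb_tofrac. Qed.

Lemma quot_comp_monomial c m : quot_comp gr (mdegree m) (emb (c *: 'X_[m])).
Proof.
exists (mdegree m), 0, (\n_(repr c) *: 'X_[m]), (\d_(repr c))%:MP; split.
- by right; exists \n_(repr c), m.
- right; exists \d_(repr c), 0%MM; split; last by rewrite mpolyX0 alg_mpolyC.
  by apply/rowP => i; rewrite !mxE mnm0E.
- by apply/eqP; rewrite mpolyC_eq0 denom_ratioP.
- by rewrite subr0.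
- by rewrite embZ const_embE -mul_mpolyC rmorphM mulrAC.
Qed.

(** The graded quotient field contains Laurent monomials as well. If a
    polynomial F satisfies b X^k F = a X^m with b nonzero, then comparing
    coefficients leaves room for a single exponent l in F, with k + l = m. *)
Lemma quot_comp_emb g F :
  quot_comp gr g (emb F) -> exists c m, F = c *: 'X_[m].
Proof.
move=> [a [b [f [h [fa hb h0 _ ]]]]].
case: fa => [->|[a' [m [_ ->]]]].
  rewrite rmorph0 mul0r -(rmorph0 emb) => /emb_inj ->.
  by exists 0, 0%MM; rewrite scale0r.
case: hb => [//|[b' [k [_ hE]]]].
have b'0 : b' != 0 by apply: contra_not_neq h0 => b0; rewrite hE b0 scale0r.
have hL : toL h != 0 by rewrite tofrac_eq0; apply/eqP.
move/(canLR (divfK hL)); rewrite -!emb_tofrac -rmorphM hE => /emb_inj.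
rewrite /= !map_mpolyZ !map_mpolyX => FE.
have coefF l : F@_l * toK b' = toK a' * ((m == (k + l)%MM)%:R).
  have := congr1 (mcoeff (k + l)%MM) FE.
  by rewrite -scalerAr mcoeffZ mcoeffMX mcoeffZ mcoeffX mulrC.
have [F0|F0] := eqVneq F 0; first by exists 0, 0%MM; rewrite F0 scale0r.
exists F@_(mlead F), (mlead F); apply/mpolyP => l.
rewrite mcoeffZ mcoeffX.
have b'K : toK b' != 0 by rewrite tofrac_eq0.
have [<-|lF] := eqVneq; first by rewrite mulr1.
rewrite mulr0; apply/eqP; apply: contraNT lF => Fl.
(* The exponents of all nonzero terms of F are equal to m - k. *)
have mE j : F@_j != 0 -> m = (k + j)%MM.
  move=> Fj; apply/eqP; have := coefF j; case: eqP => // _ /eqP.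
  by rewrite mulr0 mulf_eq0 (negbTE Fj) (negbTE b'K).
rewrite -(eqm_add2l k) -(mE l Fl) -(mE (mlead F)) //.
by rewrite mleadc_eq0.
Qed.

Lemma graded_mono_set D :
  (forall m, D m 0) -> graded_subset (quot_comp gr) (mono_set D).
Proof.
move=> D0 _ [F DF <-].
pose mon z := [pick m : seq_sub (msupp F) | mdegree (ssval m) == z].
pose f z := if mon z is Some m then emb (F@_(ssval m) *: 'X_[ssval m]) else 0.
have fE m : m \in msupp F -> f (mdegree m) = emb (F@_m *: 'X_[m]).
  move=> mF; rewrite /f /mon; case: pickP => [k /eqP/mdegree_inj -> //|].
  by move=> /(_ (SeqSub mF)); rewrite eqxx.
exists (map (@mdegree n) (msupp F)), f; split.
- by rewrite (map_inj_uniq (@mdegree_inj n)) msupp_uniq.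
- move=> _ /mapP[m mF ->]; rewrite fE //; split; first exact: quot_comp_monomial.
  exact/mono_set_monomial.
- rewrite big_map [in LHS](mpolyE F) raddf_sum /=.
  by apply: eq_big_seq => m mF; rewrite fE.
Qed.

Lemma graded_overring_polys B :
  overring B -> graded_overring gr (mono_set (fun=> B)).
Proof.
move=> [Bsub AB]; have /zmod_closedP[B0 _] := GRing.subring_closedB Bsub.
split.
- exact: mono_set_subring.
- by rewrite base_mono_set; apply: mono_set_subset.
- move=> _ [F _ <-]; have [d [p [d0 dF]]] := common_denominator F.
  have dL : toL d%:MP != 0 by rewrite tofrac_eq0 mpolyC_eq0.
  exists p, d%:MP; split; last first.
    apply: (canRL (mulfK dL)); rewrite -(emb_tofrac p) -dF rmorphM mulrC /= embC.
    by rewrite const_emb_tofrac.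
  split; first by apply/eqP; rewrite mpolyC_eq0.
  exists 0; right; exists d, 0%MM; split; last by rewrite mpolyX0 alg_mpolyC.
  by apply/rowP => i; rewrite !mxE mnm0E.
- exact: graded_mono_set.
Qed.

End PolynomialEmbedding.

(** * Homogeneous primes of C[X_1, ..., X_n] and going-down *)

Section HomogeneousPrimes.
Variables (A : idomainType) (n : nat).

Local Notation K := {fraction A}.
Local Notation L := {fraction {mpoly A[n]}}.
Local Notation emb := (emb A n).
Local Notation gr := (natural_grading A n).
Local Notation polys C := (@mono_set A n (fun=> C)).

Implicit Types (D E : 'X_{1..n} -> set K) (B C q : set K) (I : set 'I_n).
Implicit Types (F G : {mpoly K[n]}) (Q : set L).

Lemma prime_ideal_proper (F : fieldType) (S P : set F) :
  prime_ideal S P -> ~ P 1.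
Proof.
move=> [[PS _ PM] PneS _] P1; apply: PneS; apply/seteqP; split=> // x Sx.
by rewrite -[x]mulr1; apply: PM.
Qed.

(** The ideal q C[X] + (X_i : i in I) of C[X]: a coefficient is unconstrained in
    C when its monomial involves a variable of I, and lies in q otherwise. *)
Definition face_coef C q I (m : 'X_{1..n}) : set K :=
  [set c | C c /\ ((exists2 i, I i & m i <> 0%N) \/ q c)].

Definition face C q I : set L := mono_set (face_coef C q I).

Lemma face_coef_zmod C q I m :
  GRing.zmod_closed (mem C) -> GRing.zmod_closed (mem q) ->
  GRing.zmod_closed (mem (face_coef C q I m)).
Proof.
move=> /zmod_closedP[C0 CB] /zmod_closedP[q0 qB]; apply/zmod_closedP; split.
  by split=> //; right.
move=> x y [Cx qx] [Cy qy]; split; first exact: CB.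
case: qx => [|qx]; first by left.
case: qy => [|qy]; first by left.
by right; apply: qB.
Qed.

Lemma face_ideal C q I :
  GRing.subring_closed (mem C) -> ideal C q -> ideal (polys C) (face C q I).
Proof.
move=> Csub [qC qz qM]; have Cz := GRing.subring_closedB Csub.
have /subring_closedP[_ _ CM] := Csub.
have Dz m : GRing.zmod_closed (mem (face_coef C q I m)).
  exact: face_coef_zmod.
split; first by apply: mono_set_subset => m c [].
  exact: mono_set_zmod.
move=> x y; apply: mono_setM => // m k a b Ca [Cb qb]; split; first exact: CM.
case: qb => [[i Ii ki]|qb]; last by right; apply: qM.
by left; exists i; rewrite // mnmDE => /eqP; rewrite addn_eq0 => /andP[_ /eqP].
Qed.

Lemma truncation D F : (forall m, D m 0) ->
  exists F1, forall m, F1@_m = if `[< D m F@_m >] then 0 else F@_m.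
Proof.
move=> D0; pose c k := if `[< D k F@_k >] then 0 else F@_k.
exists (\sum_(k <- msupp F) c k *: 'X_[k]) => m; rewrite -/(c m) raddf_sum /=.
have coefE k : (c k *: 'X_[k])@_m = if k == m then c k else 0.
  by rewrite mcoeffZ mcoeffX; case: eqP; rewrite ?mulr1 ?mulr0.
under eq_bigr do rewrite coefE.
have [mF|mF] := boolP (m \in msupp F).
  rewrite (bigD1_seq m) ?msupp_uniq //= eqxx big1 ?addr0 // => k /negbTE-> //.
rewrite big_seq big1 => [|k kF]; first by rewrite /c memN_msupp_eq0 // if_same.
by case: eqP kF mF => // -> ->.
Qed.

(** Discarding the terms of F that satisfy D puts a term that violates D in
    leading position, without changing F modulo D. *)
Lemma lead_outside D F :
  (forall m, GRing.zmod_closed (mem (D m))) -> ~ (forall m, D m F@_m) ->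
  exists F1, [/\ forall m, F1@_m = 0 \/ F1@_m = F@_m,
                 forall m, D m (F - F1)@_m & ~ D (mlead F1) (mleadc F1)].
Proof.
move=> Dz notDF; have D0 m : D m 0 by have /zmod_closedP[] := Dz m.
have [F1 F1E] := truncation F D0; exists F1; split=> [m|m|].
- by rewrite F1E; case: ifP; [left|right].
- by rewrite mcoeffB F1E; case: asboolP; rewrite ?subr0 // subrr.
- have F10 : F1 != 0.
    apply: contra_not_neq notDF => F10 m; have := F1E m.
    rewrite F10 mcoeff0; case: asboolP => // _ <-; exact: D0.
  rewrite -mleadc_eq0 in F10; move: F10; rewrite F1E.
  by case: asboolP; rewrite ?eqxx.
Qed.

(** For primality, take F and G outside the ideal. Discarding the terms that lie
    in it, the two leading terms lie outside, and the leading term of the product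
    is their product. Its exponent avoids I because both factors do, so
    its coefficient would have to lie in the prime q. *)
Lemma face_hSpec C q I : GRing.subring_closed (mem C) -> prime_ideal C q ->
  hSpec gr (polys C) (face C q I).
Proof.
move=> Csub Cq; have [qid _ qprime] := Cq; have [qC qz qM] := qid.
have Cz := GRing.subring_closedB Csub; have /zmod_closedP[C0 _] := Cz.
have Dz m : GRing.zmod_closed (mem (face_coef C q I m)).
  exact: face_coef_zmod.
have D0 m : face_coef C q I m 0 by have /zmod_closedP[] := Dz m.
have fid := face_ideal I Csub qid; have [_ fz fM] := fid.
have /zmod_closedP[_ fB] := fz.
split; last exact: graded_mono_set.
split=> //.
  move=> fE; have /subring_closedP[S1 _ _] := mono_set_subring n Csub.
  move: S1; rewrite -fE -(rmorph1 emb) -mpolyC1 => /mono_set_const-/(_ D0).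
  by case=> _ [[i _]|/(prime_ideal_proper Cq)//]; rewrite mnm0E.
move=> _ _ [F CF <-] [G CG <-] fFG; apply: contrapT => /not_orP[].
rewrite /face !mono_setE => /(lead_outside Dz)[F1 [F1E fF1 F1lead]].
move=> /(lead_outside Dz)[G1 [G1E fG1 G1lead]].
have CF1 m : C F1@_m by have [->|->] := F1E m.
have CG1 m : C G1@_m by have [->|->] := G1E m.
have : face C q I (emb (F1 * G1)).
  (* FG is in the ideal, and F1 G1 differs from it by multiples of F - F1 and
     of G - G1. *)
  have -> : emb (F1 * G1) =
    emb F * emb G - emb G * emb (F - F1) - emb F1 * emb (G - G1).
    by rewrite -!rmorphM -!rmorphB /=; congr (emb _); ring.
  by apply: (fB); [apply: (fB) => //|]; apply: fM; apply/mono_setE.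
rewrite /face mono_setE => /(_ (mlead F1 + mlead G1)%MM).
rewrite mleadcM => -[_ [[i Ii]|]].
  rewrite mnmDE => FGi; have [Fi|Fi] := eqVneq (mlead F1 i) 0%N.
    apply: G1lead; split=> //; left; exists i => // Gi; apply: FGi.
    by rewrite Fi Gi.
  by apply: F1lead; split=> //; left; exists i => //; apply/eqP.
case/qprime => // qlead; [apply: F1lead|apply: G1lead]; split=> //; by right.
Qed.

Definition trace Q : set K := [set c | Q (emb c%:MP)].
Definition vars Q : set 'I_n := [set i | Q (emb 'X_i)].

(** The elements of C[X] outside a prime are closed under products, and a
    monomial is a product of variables. *)
Lemma prime_monomial C Q m : GRing.subring_closed (mem C) ->
  prime_ideal (polys C) Q -> Q (emb 'X_[m]) -> exists2 i, vars Q i & m i <> 0%N.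
Proof.
move=> Csub Qp; have [_ _ Qprime] := Qp; have Q1 := prime_ideal_proper Qp.
have /subring_closedP[S1 _ SM] := mono_set_subring n Csub.
have /zmod_closedP[C0 _] := GRing.subring_closedB Csub.
have /subring_closedP[C1 _ _] := Csub.
move=> Qm; apply: contrapT => noi.
suff [] : polys C (emb 'X_[m]) /\ ~ Q (emb 'X_[m]) by case.
have outM x y : polys C x /\ ~ Q x -> polys C y /\ ~ Q y ->
    polys C (x * y) /\ ~ Q (x * y).
  move=> [Sx Qx] [Sy Qy]; split; first exact: SM.
  by case/Qprime.
rewrite mpolyXE_id rmorph_prod.
apply: (big_ind (fun x => polys C x /\ ~ Q x)) => // i _.
rewrite rmorphXn /=.
have [->|mi] := eqVneq (m i) 0%N; first by rewrite expr0.
elim: (m i) => [|k IHk]; rewrite ?expr0 // exprS; apply: outM => //; split.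
  by rewrite -['X_i]scale1r; apply/mono_set_monomial.
by move=> Qi; apply: noi; exists i => //; apply/eqP.
Qed.

Lemma trace_prime C Q : GRing.subring_closed (mem C) ->
  prime_ideal (polys C) Q -> prime_ideal C (trace Q).
Proof.
move=> Csub Qp; have [[QS /zmod_closedP[Q0 QB] QM] _ Qprime] := Qp.
have /zmod_closedP[C0 _] := GRing.subring_closedB Csub.
have SC c : polys C (emb c%:MP) <-> C c by rewrite mono_set_const.
split; first split.
- by move=> c /QS/SC.
- apply/zmod_closedP; split; first by rewrite /trace /= mpolyC0 rmorph0.
  by move=> c d Qc Qd; rewrite /trace /= mpolyCB rmorphB; apply: QB.
- by move=> a c /SC Ca Qc; rewrite /trace /= mpolyCM rmorphM; apply: QM.
- move=> QC; apply: (prime_ideal_proper Qp).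
  have /subring_closedP[+ _ _] := Csub.
  by rewrite -QC /trace /= mpolyC1 rmorph1.
- move=> c d /SC Cc /SC Cd; rewrite /trace /= mpolyCM rmorphM.
  exact: Qprime.
Qed.

(** A homogeneous prime is determined by its constants and its variables: its
    homogeneous elements are terms c X^m with c in C, and if c X^m belongs to the
    prime, then so does c or one of the variables that occur in X^m. *)
Lemma hSpec_face C Q : GRing.subring_closed (mem C) -> hSpec gr (polys C) Q ->
  Q = face C (trace Q) (vars Q).
Proof.
move=> Csub [Qp Qgr]; have [[QS Qz QM] _ Qprime] := Qp.
have /zmod_closedP[C0 _] := GRing.subring_closedB Csub.
have /subring_closedP[C1 _ _] := Csub.
have [[_ tz _] _ _] := trace_prime Csub Qp.
have Dz m : GRing.zmod_closed (mem (face_coef C (trace Q) (vars Q) m)).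
  by apply: face_coef_zmod => //; exact: GRing.subring_closedB.
have D0 m : face_coef C (trace Q) (vars Q) m 0 by have /zmod_closedP[] := Dz m.
have SX m : polys C (emb 'X_[m]).
  by rewrite -['X_[m]]scale1r; apply/mono_set_monomial.
apply/seteqP; split=> [x /Qgr[s [f [_ fs ->]]]|_ [F DF <-]].
  apply: zmod_closed_sum => [|g /fs[fg Qf]]; first exact: mono_set_zmod.
  have [F CF FE] := QS _ Qf; rewrite -FE in fg Qf *.
  have [c [m FcX]] := quot_comp_emb fg; rewrite {}FcX in fg Qf FE CF *.
  have Cc : C c.
    by rewrite -(@mono_set_monomial _ n (fun=> C) c m) //; exists (c *: 'X_[m]).
  apply/mono_set_monomial => //; split=> //.
  have Sc : polys C (emb c%:MP) by apply/mono_set_const.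
  move: Qf; rewrite -mul_mpolyC rmorphM => Qf.
  have [Qc|Qm] := Qprime _ _ Sc (SX m) Qf; first by right.
  by left; apply: (prime_monomial Csub Qp).
rewrite (mpolyE F) raddf_sum; apply: zmod_closed_sum => // m _.
have [Cm] := DF m; rewrite /= -mul_mpolyC rmorphM => -[[i Qi mi]|Qc].
  apply: (QM); first exact/mono_set_const.
  have -> : m = ((m - U_(i)) + U_(i))%MM.
    by rewrite submK // lep1mP; apply/eqP.
  by rewrite mpolyXD rmorphM; apply: QM.
by rewrite mulrC; apply: QM.
Qed.

Lemma trace_base C Q :
  GRing.subring_closed (mem C) -> trace (Q `&` polys C) = trace Q `&` C.
Proof.
move=> Csub; have /zmod_closedP[C0 _] := GRing.subring_closedB Csub.
apply/seteqP; split=> c [Qc Cc]; split=> //.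
  exact/(@mono_set_const _ n (fun=> C)).
exact/(@mono_set_const _ n (fun=> C)).
Qed.

Lemma face_base B C q I : C `<=` B ->
  face B q I `&` polys C = face C (q `&` C) I.
Proof.
move=> CB; rewrite /face mono_setI; congr mono_set; apply/funext => m.
apply/seteqP; split=> [c [[Bc qc] Cc]|c [Cc qc]]; split=> //.
- by case: qc => [|qc]; [left|right].
- by split; [exact: CB|case: qc => [|[]]; [left|right]].
Qed.

(** Going-down is needed only for the constants of the three given primes. The
    variables of the prime P to be lifted are already in Q', because P is contained
    in Q = Q' `&` A[X], so the face of B[X] with these same variables solves the
    problem. *)
Lemma gGD_polys B : overring B ->
  going_down (base A) (Spec (base A)) (Spec B) -> gGD gr (polys B).
Proof.
move=> [Bsub AB] GD; rewrite /gGD base_mono_set => P Q Q' hP hQ hQ' PQ Q'Q.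
have Asub := base_subring A; have Bz := GRing.subring_closedB Bsub.
have [pP pQ pQ'] : [/\ prime_ideal (polys (base A)) P,
  prime_ideal (polys (base A)) Q & prime_ideal (polys B) Q'].
  by split; [case: hP|case: hQ|case: hQ'].
have PE := hSpec_face Asub hP; have Q'E := hSpec_face Bsub hQ'.
have [|p' [p'B p'Q' p'P]] := GD (trace P) (trace Q) (trace Q')
  (trace_prime Asub pP) (trace_prime Asub pQ) (trace_prime Bsub pQ')
  (fun c => @PQ _).
  by rewrite -trace_base // Q'Q.
exists (face B p' (vars P)); split.
- exact: face_hSpec.
- rewrite Q'E; apply: mono_set_subset => m c [Bc fc]; split=> //.
  case: fc => [[i Pi mi]|p'c]; last by right; apply: p'Q'.
  by left; exists i => //; have := PQ _ Pi; rewrite -Q'Q => -[].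
- by rewrite face_base // p'P -PE.
Qed.

(** If B[X] is the localization of A[X] at W, every w in W is a unit of K[X],
    hence a constant; comparing constant coefficients, B is the localization of A
    at the constants in W. *)
Lemma localization_descent B :
  GRing.subring_closed (mem B) ->
  is_localization (polys B) -> is_localization B.
Proof.
move=> Bsub [W [[W1 WM W0] SW]].
have /zmod_closedP[B0 _] := GRing.subring_closedB Bsub.
have /subring_closedP[B1 _ _] := Bsub.
have W_const w : W w -> exists2 c, w = c%:MP & c != 0.
  move=> Ww; have w0 : w != 0 by apply: contra_not_neq W0 => <-.
  have : polys B ((tofrac w)^-1).
    by rewrite SW; exists 1, w; rewrite rmorph1 mul1r.
  move=> [G _ GE]; have /emb_inj wG1 : emb (coef_frac A n w * G) = emb 1.
    by rewrite rmorphM /= GE emb_tofrac rmorph1 divff ?tofrac_eq0.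
  have : coef_frac A n w \is a GRing.unit.
    by apply/unitrP; exists G; rewrite mulrC wG1.
  case/andP=> /eqP wE _; have wc : w = (w@_0%MM)%:MP.
    apply/mpolyP => m; have := congr1 (mcoeff m) wE.
    rewrite !mcoeffC !mcoeff_map_mpoly; case: (m == 0%MM) => /eqP.
      by rewrite !mulr1 tofrac_eq => /eqP.
    by rewrite !mulr0 tofrac_eq0 => /eqP.
  by exists w@_0%MM => //; move: w0; rewrite {1}wc mpolyC_eq0.
exists [set a | W a%:MP]; split.
  split=> [|a b Wa Wb|] /=; rewrite ?mpolyC1 ?mpolyC0 ?mpolyCM //.
  exact: WM.
apply/seteqP; split=> [b Bb|_ [a [w [Ww ->]]]].
  have : polys B (emb b%:MP) by apply/mono_set_const.
  rewrite SW => -[r [w [Ww bE]]]; have [c wc c0] := W_const w Ww.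
  exists r@_0%MM, c; split; first by rewrite /= -wc.
  have wL : tofrac w != 0 by rewrite tofrac_eq0 wc mpolyC_eq0.
  move: bE => /(canLR (divfK wL)); rewrite -!emb_tofrac -rmorphM => /emb_inj.
  move=> /(congr1 (mcoeff 0%MM)); rewrite mcoeffCM !mcoeff_map_mpoly.
  rewrite wc mcoeffC eqxx mulr1 => bc.
  by apply: (canRL (mulfK _)); rewrite ?tofrac_eq0.
have w0 : w != 0 by apply: contra_not_neq W0 => w0; move: Ww; rewrite /= w0 mpolyC0.
apply/(@mono_set_const _ n (fun=> B)) => //; rewrite SW.
exists a%:MP, w%:MP; split=> //.
by rewrite embC fmorph_div /= !const_emb_tofrac.
Qed.

End HomogeneousPrimes.

Theorem corollary2p39 (A : idomainType) (n : nat) :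
  graded_globally_perinormal (natural_grading A n) -> globally_perinormal A.
Proof.
move=> Hgr B Bover GD; have [Bsub _] := Bover.
apply: (@localization_descent A n) => //.
by apply: Hgr; [exact: graded_overring_polys|exact: gGD_polys].
Qed.
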